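(* Let $\mathfrak{A}$ and $\mathfrak{A}'$ be two alternative $*$-algebras with identities $1_{\mathfrak{A}}$ and $1_{\mathfrak{A}'}$, respectively, and let $e_1$ and $e_2 = 1_{\mathfrak{A}} - e_1$ be nontrivial symmetric idempotents in $\mathfrak{A}$. Let $n\ge2$ be an integer and let $\varphi:\mathfrak{A}\to\mathfrak{A}'$ be a bijective unital map preserving complex scalar multiplication, i.e. $\varphi(\lambda a)=\lambda\varphi(a)$ for all $\lambda\in\mathbb{C}$, $a\in\mathfrak{A}$. Suppose that for each $j\in\{1,2\}$ and each $x\in\mathfrak{A}$, $(e_j\mathfrak{A})x=\{0\}$ implies $x=0$, and that for each $j\in\{1,2\}$ and each $y\in\mathfrak{A}'$, $(\varphi(e_j)\mathfrak{A}')y=\{0\}$ implies $y=0$. Then $\varphi$ is a multiplicative $*$-Lie $n$-map if and only if $\varphi$ is a $*$-isomorphism.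
   Context: All algebras are over the field of complex numbers $\mathbb{C}$ and are not assumed associative or commutative. An algebra $\mathfrak{A}$ is alternative if $a^2b = a(ab)$ and $ba^2 = (ba)a$ for all $a,b\in\mathfrak{A}$. A $*$-algebra is an algebra endowed with an involution, i.e. a map $*:\mathfrak{A}\to\mathfrak{A}$ with $(x+y)^*=x^*+y^*$, $(x^* )^*=x$ and $(xy)^*=y^*x^*$ for all $x,y\in\mathfrak{A}$. An element $s$ is symmetric if $s^*=s$. An idempotent $e_1$ is nontrivial if $e_1\neq 0$ and $e_1 \neq 1_{\mathfrak{A}}$. The notation $(e_j\mathfrak{A})x=\{0\}$ means $(e_ja)x=0$ for all $a\in\mathfrak{A}$, and similarly in $\mathfrak{A}'$. In a $*$-algebra put $[x_1,x_2]_*=x_1x_2-x_2x_1^*$, and define recursively $p_{1_*}(x)=x$ and $p_{n_*}(x_1,\ldots,x_n)=[p_{(n-1)_*}(x_1,\ldots,x_{n-1}),x_n]_*$ for $n\ge 2$. A map $\varphi:\mathfrak{A}\to\mathfrak{A}'$ (not assumed additive) is a multiplicative $*$-Lie $n$-map if $\varphi(p_{n_*}(x_1,\ldots,x_n))=p_{n_*}(\varphi(x_1),\ldots,\varphi(x_n))$ for all $x_1,\ldots,x_n\in\mathfrak{A}$. It is unital if $\varphi(1_{\mathfrak{A}})=1_{\mathfrak{A}'}$. It is a $*$-isomorphism if it is bijective, additive, and preserves products ($\varphi(ab)=\varphi(a)\varphi(b)$), scalar multiplication, and involution ($\varphi(a^* )=\varphi(a)^*$). *)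

(* Defs.v *)
From HB Require Import structures.
From mathcomp Require Import all_boot all_order all_algebra.
From mathcomp Require Import reals.
From mathcomp Require Export complex.

Set Implicit Arguments.
Unset Strict Implicit.
Unset Printing Implicit Defensive.

Import GRing.Theory.
Local Open Scope ring_scope.

Declare Scope na_scope.
Delimit Scope na_scope with NA.
Reserved Notation "x ** y" (at level 40, left associativity).

(* MathComp's algebra structures (lalgType, algType, and so on) are all
   associative, so the nonassociative product is built directly on lmodType. *)
HB.mixin Record Lmodule_isNonassocAlgebra (K : pzRingType) A
    of GRing.Lmodule K A := {
  namul : A -> A -> A;
  namulDl : forall a b c : A, namul (a + b) c = namul a c + namul b c;
  namulDr : forall a b c : A, namul a (b + c) = namul a b + namul a c;
  namulZl : forall (k : K) (a b : A), namul (k *: a) b = k *: namul a b;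
  namulZr : forall (k : K) (a b : A), namul a (k *: b) = k *: namul a b
}.

#[short(type="nonassocAlgType")]
HB.structure Definition NonassocAlgebra (K : pzRingType) :=
  { A of GRing.Lmodule K A & Lmodule_isNonassocAlgebra K A }.

Notation "x ** y" := (namul x y) : na_scope.
Local Open Scope na_scope.

(* The identity is allowed to be zero, as in the trivial algebra. *)
HB.mixin Record NonassocAlgebra_hasIdentity (K : pzRingType) A
    of NonassocAlgebra K A := {
  naone : A;
  namul1l : forall a : A, naone ** a = a;
  namul1r : forall a : A, a ** naone = a
}.

HB.mixin Record NonassocAlgebra_isAlternative (K : pzRingType) A
    of NonassocAlgebra K A := {
  alternativel : forall a b : A, (a ** a) ** b = a ** (a ** b);
  alternativer : forall a b : A, b ** (a ** a) = (b ** a) ** a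
}.

(* No compatibility between the involution and scalar multiplication is
   required: it may be linear, conjugate-linear, or neither. *)
HB.mixin Record NonassocAlgebra_hasInvolution (K : pzRingType) A
    of NonassocAlgebra K A := {
  star : A -> A;
  starD : forall a b : A, star (a + b) = star a + star b;
  starK : forall a : A, star (star a) = a;
  starM : forall a b : A, star (a ** b) = star b ** star a
}.

#[short(type="altStarAlgType")]
HB.structure Definition AltStarAlgebra (K : pzRingType) :=
  { A of NonassocAlgebra K A & NonassocAlgebra_hasIdentity K A
       & NonassocAlgebra_isAlternative K A
       & NonassocAlgebra_hasInvolution K A }.

Arguments naone {K} s : rename.

Section StarAlgebra.
Variables (K : pzRingType) (A : altStarAlgType K).
Implicit Types (x y e : A) (s : seq A).

Definition symmetric_elt e := star e = e.

Definition nontrivial_idempotent e :=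
  [/\ e ** e = e, e <> 0 & e <> naone A].

Definition star_lie x y := x ** y - y ** star x.

(* p_n(x_1, ..., x_n) as a function of the sequence x_1, ..., x_n; the value on
   the empty sequence is irrelevant. *)
Definition pstar s : A := if s is x :: s' then foldl star_lie x s' else 0.

Lemma pstar_rcons s y :
  s <> [::] -> pstar (rcons s y) = star_lie (pstar s) y.
Proof. by case: s => //= x s _; rewrite foldl_rcons. Qed.

End StarAlgebra.

Section Maps.
Variables (K : pzRingType) (A A' : altStarAlgType K) (phi : A -> A').

Definition star_Lie_n_map (n : nat) :=
  forall x : n.-tuple A, phi (pstar x) = pstar [seq phi a | a <- x].

Definition star_isomorphism :=
  [/\ bijective phi,
      {morph phi : a b / a + b},
      {morph phi : a b / a ** b},
      scalable phi
    & {morph phi : a / star a}].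

End Maps.

(* Main.v *)
(* Padding with units turns the n-bracket identity into identities for short
   brackets: phi(x - x^* ) = phi(x) - phi(x)^* , and phi preserves k y + y k for k
   skew and [x, h]_* for h symmetric.  If phi(t) = phi(a) + phi(b), each operation
   that phi intertwines and whose values lie where phi is already additive
   annihilates t - a - b.  Additivity thus spreads from k + h (k skew, h
   symmetric) to 1 + g with g off-diagonal, to off-diagonal skew elements, to
   symmetric, to skew and finally to all elements.  Then phi(e_i) is idempotent,
   because phi^-1(phi(e_i)^2) - e_i commutes with symmetric and anticommutes with
   skew elements; phi respects the Peirce decompositions, and the products of
   Peirce components are read off the preserved brackets, except for A_ii A_ii,
   which is tested against A_ij. *)
Require Import Defs.
From mathcomp Require Import all_boot all_order all_algebra.
From mathcomp Require Import reals.

Set Implicit Arguments.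
Unset Strict Implicit.
Unset Printing Implicit Defensive.

Import GRing.Theory.
Local Open Scope ring_scope.
Local Open Scope na_scope.

(* [ring] needs a ring, so linear identities in the nonassociative products are
   decided by comparing integer coefficients of the atoms. *)
Inductive zexp :=
  | ZVar of nat | ZZero | ZAdd of zexp & zexp | ZOpp of zexp
  | ZMuln of zexp & nat.

(** * Normal forms of linear expressions in an abelian group *)

Section ZmodNormal.
Variables (V : zmodType) (env : seq V).

Fixpoint zeval t : V :=
  match t with
  | ZVar i => env`_i
  | ZZero => 0
  | ZAdd a b => zeval a + zeval b
  | ZOpp a => - zeval a
  | ZMuln a n => zeval a *+ n
  end.

Fixpoint zcoef t (i : nat) : int :=
  match t with
  | ZVar j => (i == j)%:R
  | ZZero => 0
  | ZAdd a b => zcoef a i + zcoef b i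
  | ZOpp a => - zcoef a i
  | ZMuln a n => zcoef a i *+ n
  end.

Lemma zevalE t : zeval t = \sum_(i < size env) env`_i *~ zcoef t i.
Proof.
elim: t => [j||a IHa b IHb|a IHa|a IHa n] /=; rewrite ?IHa ?IHb.
(* A variable beyond the environment has the default value 0, and its index never occurs in the
   sum. *)
- case: (ltnP j (size env)) => hj; last first.
    rewrite nth_default // big1 // => i _.
    by rewrite ltn_eqF ?mulr0z // (leq_trans (ltn_ord i)).
  rewrite (bigD1 (Ordinal hj)) //= eqxx mulr1z big1 ?addr0 // => i.
  by rewrite -val_eqE /= => /negPf ->; rewrite mulr0z.
- by rewrite big1 // => i _; rewrite mulr0z.
- by rewrite -big_split; apply: eq_bigr => i _; rewrite mulrzDr.
- by rewrite -sumrN; apply: eq_bigr => i _; rewrite mulrNz.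
- by rewrite -sumrMnl; apply: eq_bigr => i _; rewrite -mulr_natr mulrzA natz.
Qed.

Lemma zeval_eq s t :
  all (fun i => zcoef s i == zcoef t i) (iota 0 (size env)) ->
  zeval s = zeval t.
Proof.
move=> /allP h; rewrite !zevalE; apply: eq_bigr => i _.
by rewrite (eqP (h _ _)) // mem_iota /=.
Qed.

(** Feeds a known equation [c = d] into a linear goal: [zmod] then checks that [a - b] and [c - d]
    agree as formal combinations. *)
Lemma eq_of_sub (a b c d : V) : c = d -> a - b = c - d -> a = b.
Proof. by move=> -> /eqP; rewrite subrr subr_eq0 => /eqP. Qed.

End ZmodNormal.

Ltac zpos x l :=
  lazymatch l with
  | x :: _ => constr:(0%N)
  | _ :: ?l' => let n := zpos x l' in constr:(S n)
  end.

Ltac zmem x l :=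
  lazymatch l with
  | x :: _ => constr:(true)
  | _ :: ?l' => zmem x l'
  | _ => constr:(false)
  end.

Ltac zatoms t l :=
  lazymatch t with
  | @GRing.add _ ?a ?b => let l' := zatoms a l in zatoms b l'
  | @GRing.opp _ ?a => zatoms a l
  | @GRing.zero _ => l
  | @GRing.natmul _ ?a _ => zatoms a l
  | _ => lazymatch zmem t l with true => l | false => constr:(t :: l) end
  end.

Ltac zreify t l :=
  lazymatch t with
  | @GRing.add _ ?a ?b =>
      let u := zreify a l in let v := zreify b l in constr:(ZAdd u v)
  | @GRing.opp _ ?a => let u := zreify a l in constr:(ZOpp u)
  | @GRing.zero _ => constr:(ZZero)
  | @GRing.natmul _ ?a ?n => let u := zreify a l in constr:(ZMuln u n)
  | _ => let n := zpos t l in constr:(ZVar n)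
  end.

(** Products and values of [star] are opaque atoms here, so goals are first expanded with [nadistr]
    and [stardistr]. *)
Ltac zmod :=
  lazymatch goal with
  | |- @eq ?T ?a ?b =>
      let l := zatoms a (@nil T) in
      let l := zatoms b l in
      let u := zreify a l in
      let v := zreify b l in
      apply: (@zeval_eq _ l u v); vm_compute; reflexivity
  end.

Lemma eq_or_negb (i j : bool) : i = j \/ i = ~~ j.
Proof. by case: i j => [] []; auto. Qed.

(** * Alternative identities, skew and symmetric elements *)

Section Basics.
Variables (K : pzRingType) (A : altStarAlgType K).
Implicit Types x y z : A.

(* The library's axioms are restated at [altStarAlgType], so that all products
   go through one and the same structure instance and [zmod] identifies them. *)
Lemma nmulDl x y z : (x + y) ** z = x ** z + y ** z.
Proof. exact: namulDl. Qed.

Lemma nmulDr x y z : x ** (y + z) = x ** y + x ** z.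
Proof. exact: namulDr. Qed.

Lemma nmul1l x : naone A ** x = x.
Proof. exact: namul1l. Qed.

Lemma nmul1r x : x ** naone A = x.
Proof. exact: namul1r. Qed.

Lemma altl x y : (x ** x) ** y = x ** (x ** y).
Proof. exact: alternativel. Qed.

Lemma altr x y : y ** (x ** x) = (y ** x) ** x.
Proof. exact: alternativer. Qed.

Lemma star_add x y : star (x + y) = star x + star y.
Proof. exact: Defs.starD. Qed.

Lemma star_inv x : star (star x) = x.
Proof. exact: Defs.starK. Qed.

Lemma star_mul x y : star (x ** y) = star y ** star x.
Proof. exact: Defs.starM. Qed.

Lemma namulNl x y : (- x) ** y = - (x ** y).
Proof. by rewrite -scaleN1r namulZl scaleN1r. Qed.

Lemma namulNr x y : x ** (- y) = - (x ** y).
Proof. by rewrite -scaleN1r namulZr scaleN1r. Qed.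

Lemma namul0l x : 0 ** x = 0.
Proof. by rewrite -(scale0r 0) namulZl !scale0r. Qed.

Lemma namul0r x : x ** 0 = 0.
Proof. by rewrite -(scale0r 0) namulZr !scale0r. Qed.

Lemma namulMnl x y n : (x *+ n) ** y = (x ** y) *+ n.
Proof. by rewrite -!scaler_nat namulZl. Qed.

Lemma namulMnr x y n : x ** (y *+ n) = (x ** y) *+ n.
Proof. by rewrite -!scaler_nat namulZr. Qed.

Lemma star0 : star 0 = 0 :> A.
Proof. by apply: (addrI (star 0)); rewrite -star_add !addr0. Qed.

Lemma starN x : star (- x) = - star x.
Proof. by apply: (addrI (star x)); rewrite -star_add !subrr star0. Qed.

Lemma starMn x n : star (x *+ n) = star x *+ n.
Proof. by elim: n => [|n IH]; rewrite ?star0 // !mulrS star_add IH. Qed.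

Lemma star1 : star (naone A) = naone A.
Proof.
by rewrite -[LHS]nmul1r -[X in _ ** X]star_inv -star_mul nmul1r star_inv.
Qed.

Definition nadistr :=
  (nmulDl, nmulDr, namulNl, namulNr, namulMnl, namulMnr, namul0l, namul0r,
   nmul1l, nmul1r).
Definition stardistr := 
  (star_add, starN, starMn, star0, star1, star_mul, star_inv).

Definition associator x y z := (x ** y) ** z - x ** (y ** z).

(** Linearises the left alternative law at [x + y]. With the right law this makes the associator
    alternating, the source of the Peirce rules below. *)
Lemma associatorCl x y z : associator x y z = - associator y x z.
Proof.
have := altl (x + y) z; rewrite !nadistr !altl => H.
by apply: (eq_of_sub H); rewrite /associator; zmod.
Qed.

Lemma associatorCr x y z : associator x y z = - associator x z y.
Proof.
have := altr (y + z) x; rewrite !nadistr !altr => /esym H.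
by apply: (eq_of_sub H); rewrite /associator; zmod.
Qed.

Definition skew_elt x := star x = - x.
(** Left unhalved, so that [sk x] is exactly the bracket of [x] with the unit. *)
Definition sk x := x - star x.
Definition sy x := x + star x.
Definition jordan x y := x ** y + y ** x.

Lemma skew_sk x : skew_elt (sk x).
Proof. by rewrite /skew_elt /sk !stardistr; zmod. Qed.

Lemma sym_sy x : symmetric_elt (sy x).
Proof. by rewrite /symmetric_elt /sy !stardistr; zmod. Qed.

Lemma sk_sym x : symmetric_elt x -> sk x = 0.
Proof. by rewrite /sk => ->; rewrite subrr. Qed.

Lemma sym_sk0 x : sk x = 0 -> symmetric_elt x.
Proof. by move/eqP; rewrite subr_eq0 => /eqP. Qed.

Lemma star_lie_skew x y : skew_elt x -> star_lie x y = jordan x y.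
Proof. by rewrite /star_lie /jordan => ->; rewrite namulNr opprK. Qed.

(** Since [star (star_lie x y)] is [- star_lie x (star y)], taking the skew part of a bracket
    symmetrises its second entry. *)
Lemma sk_star_lie x y : sk (star_lie x y) = star_lie x (sy y).
Proof. by rewrite /sk /sy /star_lie !stardistr !nadistr; zmod. Qed.

Lemma skew_star_lie x h : symmetric_elt h -> skew_elt (star_lie x h).
Proof. by move=> h_sym; rewrite /skew_elt /star_lie !stardistr h_sym; zmod. Qed.

Lemma skew_jordan k h : skew_elt k -> symmetric_elt h -> skew_elt (jordan k h).
Proof.
by move=> ks hs; rewrite /skew_elt /jordan !stardistr ks hs !nadistr; zmod.
Qed.

Lemma sym_jordan k l : skew_elt k -> skew_elt l -> symmetric_elt (jordan k l).
Proof.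
by move=> ks ls; rewrite /symmetric_elt /jordan !stardistr ks ls !nadistr; zmod.
Qed.

Lemma sym_star_lie h k :
  symmetric_elt h -> skew_elt k -> symmetric_elt (star_lie h k).
Proof.
move=> hs ks.
by rewrite /symmetric_elt /star_lie !stardistr ks hs !nadistr; zmod.
Qed.

Lemma flexible x y : (x ** y) ** x = x ** (y ** x).
Proof.
have := associatorCr x y x; rewrite /associator altl => H.
by apply: (eq_of_sub H); zmod.
Qed.

Lemma jordanC x y : jordan x y = jordan y x.
Proof. exact: addrC. Qed.

Lemma commutator_sqr x y :
  x ** (y ** y) - (y ** y) ** x = jordan (x ** y - y ** x) y.
Proof. by rewrite /jordan !nadistr flexible altl altr; zmod. Qed.

(** Trades the Jordan product with a square for a double commutator and a double Jordan product, the
    form that [phi] transports in [phi_frame_idem]. *)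
Lemma jordan_sqr x y :
  jordan x (y ** y) *+ 2 =
  (y ** (y ** x - x ** y) - (y ** x - x ** y) ** y) + jordan (jordan y x) y.
Proof. by rewrite /jordan !nadistr altl altr flexible; zmod. Qed.

End Basics.

Section Halving.
Variables (K : numFieldType) (A : altStarAlgType K).
Implicit Types x y : A.

Lemma muln2_inj x y : x *+ 2 = y *+ 2 -> x = y.
Proof.
rewrite -!scaler_nat; apply: scalerI.
by rewrite Num.Theory.pnatr_eq0.
Qed.

Lemma muln2_eq0 x : x *+ 2 = 0 -> x = 0.
Proof. by move=> x0; apply: muln2_inj; rewrite x0 mul0rn. Qed.

Definition halve x : A := 2%:R^-1 *: x.

Lemma halveK x : halve x *+ 2 = x.
Proof.
by rewrite -scaler_nat scalerA divff ?scale1r // Num.Theory.pnatr_eq0.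
Qed.

Lemma skew_half x : skew_elt x -> skew_elt (halve x).
Proof. by move=> xs; apply: muln2_inj; rewrite mulNrn -starMn !halveK. Qed.

Lemma sym_half x : symmetric_elt x -> symmetric_elt (halve x).
Proof. by move=> xs; apply: muln2_inj; rewrite -starMn !halveK. Qed.

Lemma sk_half_skew x : skew_elt x -> sk (halve x) = x.
Proof. by move=> /skew_half xs; rewrite /sk xs -[RHS]halveK; zmod. Qed.

Lemma sy_half_sym x : symmetric_elt x -> sy (halve x) = x.
Proof. by move=> /sym_half xs; rewrite /sy xs -[RHS]halveK; zmod. Qed.

Lemma sk_sy_half x : x = sk (halve x) + sy (halve x).
Proof. by rewrite /sk /sy -[LHS]halveK; zmod. Qed.

End Halving.

(** * Peirce decomposition of an alternative algebra *)

Section Peirce.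
Variables (K : numFieldType) (A : altStarAlgType K) (E : bool -> A).
Implicit Types (x y z c g v : A) (i j : bool).

(** Boolean indices make [~~ i] the complementary index, so each lemma treats both idempotents at
    once. *)
Definition peirce_frame :=
  [/\ forall i, E i ** E i = E i,
      forall i, symmetric_elt (E i)
    & E true + E false = naone A].

Definition faithful := forall i x, (forall a, (E i ** a) ** x = 0) -> x = 0.

Definition peirce i j x := E i ** x = x /\ x ** E j = x.

(** The projection onto the two off-diagonal Peirce components, see [offdiagE]; written with Jordan
    products because [phi] preserves these on skew elements. *)
Definition offdiag x := jordan (jordan x (E true)) (E false).

Hypothesis frame : peirce_frame.

Lemma frame_sum i : E i + E (~~ i) = naone A.
Proof. by case: frame => _ _ s; case: i; rewrite //= addrC. Qed.

Lemma frameN i : E (~~ i) = naone A - E i.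
Proof. by rewrite -(frame_sum i); zmod. Qed.

Lemma frame_idem i : E i ** E i = E i.
Proof. by case: frame. Qed.

Lemma frame_sym i : star (E i) = E i.
Proof. by case: frame => _ h _; exact: h. Qed.

Lemma frame_ll i x : E i ** (E i ** x) = E i ** x.
Proof. by rewrite -altl frame_idem. Qed.

Lemma frame_rr i x : (x ** E i) ** E i = x ** E i.
Proof. by rewrite -altr frame_idem. Qed.

Lemma frame_lNl i x : E i ** (E (~~ i) ** x) = 0.
Proof. by rewrite frameN !nadistr frame_ll; zmod. Qed.

Lemma frame_rNr i x : (x ** E i) ** E (~~ i) = 0.
Proof. by rewrite frameN !nadistr frame_rr; zmod. Qed.

(** Equal indices are the flexible law; the other case follows by writing [E (~~ i)] as
    [naone A - E i]. *)
Lemma frame_A i j x : (E i ** x) ** E j = E i ** (x ** E j).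
Proof.
have [->|->] := eq_or_negb j i.
  exact: flexible.
by rewrite frameN !nadistr flexible.
Qed.

Lemma peirce_proj i j x : peirce i j (E i ** (x ** E j)).
Proof. by split; [exact: frame_ll | rewrite -frame_A frame_rr]. Qed.

Lemma frame_suml i x : x = E i ** x + E (~~ i) ** x.
Proof. by rewrite -nmulDl frame_sum nmul1l. Qed.

Lemma frame_sumr i x : x = x ** E i + x ** E (~~ i).
Proof. by rewrite -nmulDr frame_sum nmul1r. Qed.

Lemma peirceNl i j x : peirce i j x -> E (~~ i) ** x = 0.
Proof. by move=> [h _]; rewrite frameN !nadistr h subrr. Qed.

Lemma peirceNr i j x : peirce i j x -> x ** E (~~ j) = 0.
Proof. by move=> [_ h]; rewrite frameN !nadistr h subrr. Qed.

Lemma peirce_star i j x : peirce i j x -> peirce j i (star x).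
Proof. by move=> [h h']; split; rewrite -frame_sym -star_mul ?h ?h'. Qed.

Lemma peirceD i j x y : peirce i j x -> peirce i j y -> peirce i j (x + y).
Proof. by move=> [h h'] [g g']; split; rewrite !nadistr ?h ?h' ?g ?g'. Qed.

Lemma peircel0 i j x : peirce i j x -> peirce (~~ i) j x -> x = 0.
Proof. by move=> /peirceNl h [h' _]; rewrite -h'. Qed.

Lemma associator_lt i x y : associator x (E i) y = - associator (E i) x y.
Proof. exact: associatorCl. Qed.

Lemma associator_rt i x y : associator x y (E i) = - associator x (E i) y.
Proof. exact: associatorCr. Qed.

(** For matching inner indices the associator of [x], [E l], [y] vanishes, and alternation carries
    this to the outer positions of the idempotent. *)
Lemma peirce_mul i j k x y :
  peirce i j x -> peirce j k y -> peirce i k (x ** y).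
Proof.
move=> cx cy.
have a0 l : associator x (E l) y = 0.
  rewrite /associator.
  have [->|->] := eq_or_negb l j.
    by rewrite (proj2 cx) (proj1 cy) subrr.
  by rewrite (peirceNr cx) (peirceNl cy) !nadistr subrr.
split.
  have := associator_lt i x y; rewrite a0 /associator (proj1 cx) => /esym H.
  by apply: (eq_of_sub H); zmod.
have := associator_rt k x y; rewrite a0 /associator (proj2 cy) => H.
by apply: (eq_of_sub H); zmod.
Qed.

(** For different inner indices the associator of [x], [E j], [y] is [x ** y] itself; alternation
    again moves [E j] outwards. *)
Lemma peirce_mul_gap i j k x y :
  peirce i j x -> peirce (~~ j) k y ->
  E j ** (x ** y) = x ** y + E j ** x ** y /\
  (x ** y) ** E j = x ** (y ** E j) - x ** y.
Proof.
move=> cx cy.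
have a0 : associator x (E j) y = x ** y.
  have := peirceNl cy; rewrite negbK /associator (proj2 cx) => ->.
  by rewrite !nadistr subr0.
have := associator_lt j x y; have := associator_rt j x y.
rewrite a0 /associator => Hr /esym Hl; split.
  by apply: (eq_of_sub Hl); zmod.
by apply: (eq_of_sub Hr); zmod.
Qed.

(** By the gap formula [x ** y] would be an eigenvector of left multiplication by [E j] with
    eigenvalue 2, impossible for an idempotent. In [peirce_mul0r] the eigenvalue is -1, on the
    right. *)
Lemma peirce_mul0l j k x y : peirce j j x -> peirce (~~ j) k y -> x ** y = 0.
Proof.
move=> cx cy; have [h _] := peirce_mul_gap cx cy.
have := frame_ll j (x ** y); rewrite h (proj1 cx) nmulDr h (proj1 cx) => H.
by apply: muln2_eq0; apply: (eq_of_sub H); zmod.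
Qed.

Lemma peirce_mul0r i j x y :
  peirce i j x -> peirce (~~ j) (~~ j) y -> x ** y = 0.
Proof.
move=> cx cy; have [_ h] := peirce_mul_gap cx cy.
have y0 := peirceNr cy; rewrite negbK in y0.
have := frame_rr j (x ** y); rewrite h y0 !nadistr h y0 !nadistr => H.
by apply: muln2_eq0; apply: (eq_of_sub H); zmod.
Qed.

(** The nonassociative feature: this product, zero in an associative algebra, may survive in the
    opposite component. *)
Lemma peirce_mul_off i x y :
  peirce i (~~ i) x -> peirce i (~~ i) y -> peirce (~~ i) i (x ** y).
Proof.
move=> cx cy.
have cy' : peirce (~~ (~~ i)) (~~ i) y by rewrite negbK.
have [h h'] := peirce_mul_gap cx cy'; split.
  by rewrite h (peirceNl cx) nadistr addr0.
have := frame_sumr i (x ** y); rewrite h' (proj2 cy) subrr addr0.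
by move=> <-.
Qed.

(** Right multiplication by [E (~~ i)] kills the square, which lies in the opposite component, yet
    fixes it by left alternativity. *)
Lemma peirce_sqr0 i x : peirce i (~~ i) x -> x ** x = 0.
Proof.
move=> cx; rewrite -(peirceNr (peirce_mul_off cx cx)) altl.
by rewrite (proj2 cx).
Qed.

Lemma peirce_anticomm i x y :
  peirce i (~~ i) x -> peirce i (~~ i) y -> x ** y = - (y ** x).
Proof.
move=> cx cy; have := peirce_sqr0 (peirceD cx cy).
rewrite !nadistr (peirce_sqr0 cx) (peirce_sqr0 cy) => H.
by apply: (eq_of_sub H); zmod.
Qed.

(** The associator is invariant under cyclic shifts, and with [z] in front both of its terms
    vanish. *)
Lemma peirce_assoc i x y z :
  peirce i i x -> peirce i i y -> peirce i (~~ i) z ->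
  (x ** y) ** z = x ** (y ** z).
Proof.
move=> cx cy cz.
have zN u : peirce i i u -> z ** u = 0.
  by move=> cu; apply: peirce_mul0r cz _; rewrite negbK.
have := associatorCr x y z; rewrite (associatorCl x z y) opprK /associator.
rewrite (zN _ cx) (zN _ (peirce_mul cx cy)) !nadistr => H.
by apply: (eq_of_sub H); zmod.
Qed.

Lemma offdiagE i x :
  offdiag x = E i ** (x ** E (~~ i)) + E (~~ i) ** (x ** E i).
Proof.
have -> : offdiag x = E true ** (x ** E false) + E false ** (x ** E true).
  rewrite /offdiag /jordan !nadistr (frame_rNr true) (frame_lNl false).
  by rewrite frame_A add0r addr0.
by case: i; rewrite //= addrC.
Qed.

Lemma offdiagD x y : offdiag (x + y) = offdiag x + offdiag y.
Proof. by rewrite /offdiag /jordan !nadistr; zmod. Qed.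

Lemma offdiagN x : offdiag (- x) = - offdiag x.
Proof. by rewrite /offdiag /jordan !nadistr; zmod. Qed.

Lemma offdiag_star x : offdiag (star x) = star (offdiag x).
Proof.
by rewrite !(offdiagE true) !stardistr !frame_sym !frame_A addrC.
Qed.

Lemma skew_offdiag x : skew_elt x -> skew_elt (offdiag x).
Proof. by move=> xs; rewrite /skew_elt -offdiag_star xs offdiagN. Qed.

Lemma peirce_offdiag i x : peirce i (~~ i) x -> offdiag x = x.
Proof.
move=> cx; rewrite (offdiagE i) (proj2 cx) (proj1 cx).
by have := peirceNr cx; rewrite negbK => ->; rewrite nadistr addr0.
Qed.

Lemma offdiag_idem x : offdiag (offdiag x) = offdiag x.
Proof.
rewrite (offdiagE true x) offdiagD (peirce_offdiag (peirce_proj true false x)).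
by rewrite (peirce_offdiag (peirce_proj false true x)).
Qed.

Lemma offdiag_comm i x : offdiag x = 0 -> E i ** x = x ** E i.
Proof.
rewrite (offdiagE i) => H.
have := congr1 (namul (E i)) H.
rewrite !nadistr frame_ll frame_lNl addr0 => H1.
rewrite H1 add0r in H.
by rewrite [E i ** x](frame_sumr i) [x ** E i](frame_suml i) !frame_A H1 H.
Qed.

Lemma comm_offdiag i x : E i ** x = x ** E i -> offdiag x = 0.
Proof.
move=> H; rewrite (offdiagE i) -frame_A H frame_rNr -H.
by rewrite -{2}(negbK i) frame_lNl addr0.
Qed.

Lemma frame_offdiag i x : E i ** offdiag x = E i ** (x ** E (~~ i)).
Proof. by rewrite (offdiagE i) nadistr frame_ll frame_lNl addr0. Qed.

Lemma offdiag_frame i x : offdiag x ** E i = E (~~ i) ** (x ** E i).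
Proof.
rewrite (offdiagE i) nadistr (proj2 (peirce_proj (~~ i) i x)).
have := peirceNr (peirce_proj i (~~ i) x); rewrite negbK => ->.
by rewrite add0r.
Qed.

Lemma jordan_frame i x : offdiag x = x -> jordan x (E i) = x.
Proof.
move=> ox; rewrite /jordan -{1 2}ox offdiag_frame frame_offdiag addrC.
by rewrite -offdiagE.
Qed.

(** Products within one off-diagonal component cancel by anticommutation; the others are
    diagonal. *)
Lemma offdiag_jordan x y :
  offdiag x = x -> offdiag y = y -> offdiag (jordan x y) = 0.
Proof.
move=> ox oy; apply: (comm_offdiag (i := true)).
have split_off z : offdiag z = z ->
    exists z1 z2, [/\ z = z1 + z2, peirce true false z1 & peirce false true z2].
  move=> oz; exists (E true ** (z ** E false)), (E false ** (z ** E true)).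
  by split; [rewrite -{1}oz (offdiagE true) | exact: peirce_proj..].
have [a [b [-> ca cb]]] := split_off x ox.
have [c [d [-> cc cd]]] := split_off y oy.
have -> : jordan (a + b) (c + d) = (a ** d + c ** b) + (b ** c + d ** a).
  rewrite /jordan !nadistr (@peirce_anticomm true a c ca cc).
  by rewrite (@peirce_anticomm false b d cb cd); zmod.
have [h h'] := peirceD (peirce_mul ca cd) (peirce_mul cc cb).
have h2 := peirceD (peirce_mul cb cc) (peirce_mul cd ca).
rewrite [_ ** (_ + (b ** c + _))]nmulDr [(_ + (b ** c + _)) ** _]nmulDl h h'.
by rewrite (peirceNl h2) (peirceNr h2).
Qed.

(** * Vanishing criteria from faithfulness *)

Hypothesis E_faithful : faithful.

(** Faithfulness is applied at [E (~~ k)]. Of the two components of [E (~~ k) ** a], the diagonal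
    one annihilates [x] by the Peirce rules, so only the off-diagonal one needs testing. *)
Lemma faithful_l k l x :
  peirce k l x -> (forall c, peirce (~~ k) k c -> c ** x = 0) -> x = 0.
Proof.
move=> cx h; apply: (E_faithful (i := ~~ k)) => a.
rewrite (frame_sumr k (E _ ** a)) nadistr h; last first.
  by rewrite frame_A; exact: peirce_proj.
rewrite add0r; apply: (peirce_mul0l (j := ~~ k) (k := l));
  last by rewrite negbK.
by rewrite frame_A; exact: peirce_proj.
Qed.

Lemma faithful_r k l x :
  peirce k l x -> (forall c, peirce l (~~ l) c -> x ** c = 0) -> x = 0.
Proof.
move=> cx h; rewrite -[x]star_inv.
suff -> : star x = 0 by rewrite star0.
apply: faithful_l (peirce_star cx) _ => c cc.
by rewrite -[c]star_inv -star_mul h ?star0 //; exact: peirce_star.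
Qed.

Lemma diag_peirce i v : E i ** v = v ** E i -> peirce i i (E i ** v).
Proof. by move=> vE; rewrite -(frame_ll i v) vE; exact: peirce_proj. Qed.

(** After removing the terms that vanish, the two sides of the equation lie in opposite off-diagonal
    components, so both are zero. *)
Lemma star_comm_peirce i v c : (forall j, E j ** v = v ** E j) ->
  peirce (~~ i) i c -> c ** v = v ** star c -> c ** (E i ** v) = 0.
Proof.
move=> vE cc; have cv j := diag_peirce (vE j).
have cN : c ** (E (~~ i) ** v) = 0 by apply: peirce_mul0r cc (cv _).
have cN' : (E (~~ i) ** v) ** star c = 0.
  apply: (peirce_mul0l (k := ~~ i) (cv (~~ i))); rewrite negbK.
  exact: peirce_star cc.
rewrite {1 2}(frame_suml i v) !nadistr cN cN' !addr0 => H.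
have c1 := peirce_mul cc (cv i).
have c2 := peirce_mul (cv i) (peirce_star cc).
rewrite H; apply: (peircel0 c2); split; last exact: (proj2 c2).
by rewrite -H; exact: (proj1 c1).
Qed.

Lemma star_comm_eq0 v :
  (forall i, E i ** v = v ** E i) ->
  (forall i c, peirce i (~~ i) c -> c ** v = v ** star c) -> v = 0.
Proof.
move=> vE vc.
suff v0 i : E i ** v = 0 by rewrite (frame_suml true v) !v0 addr0.
apply: (faithful_l (diag_peirce (vE i))) => c cc.
apply: star_comm_peirce => //; apply: (vc (~~ i)).
by rewrite negbK.
Qed.

Lemma diag_mul i v c : (forall j, E j ** v = v ** E j) ->
  peirce i (~~ i) c -> peirce i (~~ i) (c ** v) /\ peirce i (~~ i) (v ** c).
Proof.
move=> vE cc.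
have cv j : peirce j j (E j ** v).
  by rewrite -(frame_ll j v) (vE j); exact: peirce_proj.
have cviN : peirce (~~ i) (~~ i) (E (~~ i) ** v) by [].
have c0 : c ** (E i ** v) = 0.
  by apply: (peirce_mul0r cc); rewrite negbK.
have v0 : (E (~~ i) ** v) ** c = 0.
  by apply: (peirce_mul0l cviN (k := ~~ i)); rewrite negbK.
rewrite (frame_suml i v) !nadistr c0 v0 add0r addr0.
by split; [exact: peirce_mul cc _ | exact: peirce_mul (cv i) cc].
Qed.

Lemma sk_sy_star_lie (c v : A) :
  star_lie c v *+ 2 = jordan (sk c) v + star_lie (sy c) v.
Proof. by rewrite /star_lie /jordan (sym_sy c) /sk /sy !nadistr; zmod. Qed.

Lemma diag_eq0 v : (forall i, E i ** v = v ** E i) ->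
  (forall k, skew_elt k -> offdiag k = k -> offdiag (jordan k v) = 0) ->
  (forall g, symmetric_elt g -> offdiag g = g -> offdiag (star_lie g v) = 0) ->
  v = 0.
Proof.
move=> vE vk vg; apply: star_comm_eq0 => // i c cc.
have oc : offdiag c = c by exact: peirce_offdiag cc.
have osc : offdiag (star c) = star c by rewrite offdiag_star oc.
have : star_lie c v *+ 2 = 0; last move/muln2_eq0/eqP.
  have ov : offdiag (star_lie c v) = star_lie c v.
    have ccs : peirce (~~ i) (~~ ~~ i) (star c).
      by rewrite negbK; exact: peirce_star cc.
    rewrite /star_lie offdiagD offdiagN.
    rewrite (peirce_offdiag (proj1 (diag_mul vE cc))).
    by rewrite (peirce_offdiag (proj2 (diag_mul vE ccs))).
  rewrite -ov mulr2n -offdiagD -mulr2n sk_sy_star_lie offdiagD vk ?vg ?addr0 //.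
  - exact: sym_sy.
  - by rewrite /sy offdiagD oc osc.
  - exact: skew_sk.
  - by rewrite /sk offdiagD offdiagN oc osc.
by rewrite subr_eq0 => /eqP.
Qed.

(** Testing with [sk c], for [c] off-diagonal, leaves a difference of two terms in opposite
    components, so each vanishes and [faithful_r] applies. *)
Lemma diag_skew_eq0 v : (forall i, E i ** v = v ** E i) ->
  (forall i k, skew_elt k -> jordan (jordan v (E i)) k = 0) -> v = 0.
Proof.
move=> vE vk.
suff v0 i : E i ** v = 0 by rewrite (frame_suml true v) !v0 addr0.
have cv : peirce i i (E i ** v).
  by rewrite -(frame_ll i v) (vE i); exact: peirce_proj.
apply: (faithful_r cv) => c cc.
have c0 : c ** (E i ** v) = 0.
  by apply: (peirce_mul0r cc); rewrite negbK.
have c0' : (E i ** v) ** star c = 0 by apply: peirce_mul0l cv (peirce_star cc).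
have {vk} := vk i (sk c) (skew_sk c).
have -> : jordan (jordan v (E i)) (sk c) =
    ((E i ** v) ** c - star c ** (E i ** v)) *+ 2.
  by rewrite /jordan -vE /sk !nadistr c0 c0'; zmod.
move/muln2_eq0/eqP; rewrite subr_eq0 => /eqP H.
apply: (peircel0 (peirce_mul cv cc)); rewrite H.
split; first exact: (proj1 (peirce_mul (peirce_star cc) cv)).
by rewrite -H; exact: (proj2 (peirce_mul cv cc)).
Qed.

(** * Brackets with the idempotents, and products read off brackets *)

Lemma star_lie_frame i x :
  star_lie (E i) x = E i ** (x ** E (~~ i)) - E (~~ i) ** (x ** E i).
Proof.
rewrite /star_lie frame_sym [E i ** x](frame_sumr i).
rewrite [in LHS](frame_suml i (x ** E i)).
by rewrite !frame_A; zmod.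
Qed.

Lemma offdiag_star_lie i x : offdiag (star_lie (E i) x) = star_lie (E i) x.
Proof.
rewrite star_lie_frame // offdiagD offdiagN.
rewrite (peirce_offdiag (peirce_proj i (~~ i) x)) (@peirce_offdiag (~~ i)) //.
by have := peirce_proj (~~ i) i x; rewrite negbK.
Qed.

(** Bracketing with [E i] acts by 1 and -1 on the two off-diagonal components. *)
Lemma star_lie_frameK i x :
  offdiag x = x -> star_lie (E i) (star_lie (E i) x) = x.
Proof.
move=> ox; rewrite (star_lie_frame i x) /star_lie frame_sym !nadistr.
rewrite frame_ll frame_lNl (proj2 (peirce_proj (~~ i) i x)).
have := peirceNr (peirce_proj i (~~ i) x); rewrite negbK => ->.
by rewrite -{3}ox (offdiagE i); zmod.
Qed.

(** Symmetrising [y] gives a bracket that [phi] preserves, and passing to a Peirce corner removes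
    the extra terms. The next two lemmas treat other pairs of components, the last one with a Jordan
    product. *)
Lemma peirce_prod_diag_off i x y : peirce i i x -> peirce i (~~ i) y ->
  E i ** (star_lie x (sy y) ** E (~~ i)) = x ** y.
Proof.
move=> cx cy; have cxs := peirce_star cx; have cys := peirce_star cy.
have x0 : x ** star y = 0 by exact: peirce_mul0l cx cys.
have y0 : y ** star x = 0 by apply: (peirce_mul0r cy); rewrite negbK.
have [h h'] := peirce_mul cx cy.
have [_ /= z0] := peirce_mul cys cxs.
have zN := peirceNr (peirce_mul cys cxs).
by rewrite /star_lie /sy !nadistr x0 y0 zN !nadistr h' h; zmod.
Qed.

Lemma peirce_prod_off_off i x y : peirce i (~~ i) x -> peirce i (~~ i) y ->
  E (~~ i) ** (star_lie x (sy y) ** E i) = x ** y.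
Proof.
move=> cx cy; have cxs := peirce_star cx; have cys := peirce_star cy.
have [h h'] := peirce_mul_off cx cy.
have h1 := peirceNl (peirce_mul cx cys).
have h2 := peirceNl (peirce_mul cy cxs).
have h3 : (star y ** star x) ** E i = 0.
  have := peirce_mul_off (i := ~~ i) (x := star y) (y := star x).
  by rewrite negbK => /(_ cys cxs) /peirceNr; rewrite negbK.
rewrite /star_lie /sy !nadistr h' h3 -!frame_A !nadistr h h1 h2 !nadistr.
by zmod.
Qed.

Lemma peirce_prod_off i x y : peirce i (~~ i) x -> peirce (~~ i) i y ->
  E i ** (jordan (sk x) y ** E i) = x ** y.
Proof.
move=> cx cy; have cxs := peirce_star cx.
have [h h'] := peirce_mul cx cy.
have h1 : E i ** (y ** x) = 0.
  by have := peirceNl (peirce_mul cy cx); rewrite negbK.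
have [h2 h3] : (star x ** y) ** E i = 0 /\ (y ** star x) ** E i = 0.
  have := @peirce_mul_off (~~ i); rewrite negbK => cm.
  have := peirceNr (cm _ _ cxs cy); have := peirceNr (cm _ _ cy cxs).
  by rewrite negbK.
rewrite /jordan /sk !nadistr h' h2 h3 -!frame_A !nadistr h h1 !nadistr.
by zmod.
Qed.

End Peirce.

(** * Consequences of the short bracket identities *)

Section StarLieMap.
Variables (K : numFieldType) (A A' : altStarAlgType K).
Variables (phi : A -> A') (psi : A' -> A).
Hypotheses (phiK : cancel phi psi) (psiK : cancel psi phi).
Hypothesis phi_scal : scalable phi.
Hypothesis phi_one : phi (naone A) = naone A'.
Hypothesis phi_sk : forall x, phi (sk x) = sk (phi x).
Hypothesis phi_sk_lie : forall x y,
  phi (star_lie (sk x) y) = star_lie (sk (phi x)) (phi y).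
Hypothesis phi_lie_sk : forall x y,
  phi (sk (star_lie x y)) = sk (star_lie (phi x) (phi y)).
Hypothesis phi_lie_lie_sk : forall x y z,
  phi (sk (star_lie (star_lie x y) z)) =
  sk (star_lie (star_lie (phi x) (phi y)) (phi z)).
Implicit Types (x y z a b c g h k l s u v : A).

Lemma phi_inj : injective phi.
Proof. exact: can_inj phiK. Qed.

Lemma phi_zero : phi 0 = 0.
Proof. by rewrite -(scale0r 0) phi_scal scale0r. Qed.

Lemma phi_opp x : phi (- x) = - phi x.
Proof. by rewrite -scaleN1r phi_scal scaleN1r. Qed.

Lemma phi_muln x n : phi (x *+ n) = phi x *+ n.
Proof. by rewrite -!scaler_nat phi_scal. Qed.

Lemma phi_halve x : phi (halve x) = halve (phi x).
Proof. exact: phi_scal. Qed.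

Lemma phi_skew k : skew_elt k -> skew_elt (phi k).
Proof. by move=> ks; rewrite -(sk_half_skew ks) phi_sk; exact: skew_sk. Qed.

Lemma phi_sym h : symmetric_elt h -> symmetric_elt (phi h).
Proof. by move=> hs; apply: sym_sk0; rewrite -phi_sk sk_sym // phi_zero. Qed.

Lemma phi_sym_inv x : symmetric_elt (phi x) -> symmetric_elt x.
Proof.
by move=> xs; apply: sym_sk0; apply: phi_inj; rewrite phi_sk sk_sym ?phi_zero.
Qed.

Lemma phi_skew_inv x : skew_elt (phi x) -> skew_elt x.
Proof.
move=> xs; suff -> : x = halve (sk x) by apply: skew_half; exact: skew_sk.
apply: phi_inj; rewrite phi_halve phi_sk; apply: muln2_inj.
by rewrite halveK /sk xs; zmod.
Qed.

Lemma phi_jordan k y : skew_elt k -> phi (jordan k y) = jordan (phi k) (phi y).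
Proof.
move=> ks; rewrite -!star_lie_skew //; last exact: phi_skew.
by rewrite -{1}(sk_half_skew ks) phi_sk_lie -phi_sk sk_half_skew.
Qed.

(** A symmetric [h] is [sy (halve h)], so [sk_star_lie] turns this bracket into the skew part of a
    bracket. *)
Lemma phi_star_lie x h :
  symmetric_elt h -> phi (star_lie x h) = star_lie (phi x) (phi h).
Proof.
move=> hs; rewrite -{1}(sy_half_sym hs) -sk_star_lie phi_lie_sk sk_star_lie.
by rewrite phi_halve sy_half_sym //; exact: phi_sym.
Qed.

Lemma phi_star_lie_lie x y h : symmetric_elt h ->
  phi (star_lie (star_lie x y) h) = star_lie (star_lie (phi x) (phi y)) (phi h).
Proof.
move=> hs; rewrite -{1}(sy_half_sym hs) -sk_star_lie phi_lie_lie_sk.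
by rewrite sk_star_lie phi_halve sy_half_sym //; exact: phi_sym.
Qed.

(** * The involution and additivity *)

Variable E : bool -> A.
Hypotheses (frame : peirce_frame E) (E_faithful : faithful E).

Let E' i := phi (E i).

(** The preimage [t] of [sy (phi x)] and [sy x] have the same bracket with every [z], hence coincide
    by [star_comm_eq0]. *)
Lemma phi_sy x : phi (sy x) = sy (phi x).
Proof.
set t := psi (sy (phi x)).
have phit : phi t = sy (phi x) by exact: psiK.
have ts : symmetric_elt t by apply: phi_sym_inv; rewrite phit; exact: sym_sy.
suff -> : sy x = t by [].
suff : sy x - t = 0 by move/eqP; rewrite subr_eq0 => /eqP.
have h z : star_lie z (sy x - t) = 0.
  have : star_lie z (sy x) = star_lie z t.
    apply: phi_inj; rewrite [RHS]phi_star_lie // phit -sk_star_lie phi_lie_sk.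
    by rewrite sk_star_lie.
  by move=> H; apply: (eq_of_sub H); rewrite /star_lie !nadistr; zmod.
apply: (star_comm_eq0 frame E_faithful) => [i|i c _].
  have := h (E i); rewrite /star_lie (frame_sym frame) => /eqP.
  by rewrite subr_eq0 => /eqP.
by have := h c; rewrite /star_lie => /eqP; rewrite subr_eq0 => /eqP.
Qed.

Lemma phi_star x : phi (star x) = star (phi x).
Proof.
have h1 := phi_sy (star x); have h2 := phi_sk (star x).
have h3 := phi_sy x; have h4 := phi_sk x.
have e1 : sy (star x) = sy x by rewrite /sy star_inv addrC.
have e2 : sk (star x) = - sk x by rewrite /sk star_inv; zmod.
rewrite e1 h3 in h1; rewrite e2 phi_opp h4 in h2.
apply: muln2_inj.
have H : sy (phi x) - sk (phi x) = sy (phi (star x)) + sk (phi (star x)).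
  by rewrite h1 h2.
by apply: (eq_of_sub (esym H)); rewrite /sy /sk; zmod.
Qed.

(** An element is determined by its [sk] and [sy], both of which [phi] already preserves. *)
Lemma phi_add_skew_sym k h :
  skew_elt k -> symmetric_elt h -> phi (k + h) = phi k + phi h.
Proof.
move=> ks hs; set t := psi (phi k + phi h).
have phit : phi t = phi k + phi h by exact: psiK.
suff -> : k + h = t by [].
have tk : sk t = k *+ 2.
  apply: phi_inj; rewrite phi_sk phit phi_muln /sk stardistr (phi_skew ks).
  by rewrite (phi_sym hs); zmod.
have th : sy t = h *+ 2.
  apply: phi_inj; rewrite phi_sy phit phi_muln /sy stardistr (phi_skew ks).
  by rewrite (phi_sym hs); zmod.
apply: muln2_inj; have : k *+ 2 + h *+ 2 = sk t + sy t by rewrite tk th.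
by rewrite /sk /sy => H; apply: (eq_of_sub H); zmod.
Qed.

Lemma phi_offdiag_skew k :
  skew_elt k -> phi (offdiag E k) = offdiag E' (phi k).
Proof.
move=> ks; rewrite /offdiag phi_jordan ?phi_jordan //.
by apply: skew_jordan => //; exact: frame_sym frame true.
Qed.

Lemma phi_frame_sym i : star (E' i) = E' i.
Proof. by apply: phi_sym; exact: (frame_sym frame). Qed.

(** Brackets with symmetric elements ignore the unit, and off-diagonal parts of Jordan products with
    off-diagonal [k] ignore [g]. Each test thus meets only one of the two summands. *)
Lemma phi_add1 g : symmetric_elt g -> offdiag E g = g ->
  phi (naone A + g) = naone A' + phi g.
Proof.
move=> gs og; set t := psi (naone A' + phi g).
have phit : phi t = naone A' + phi g by exact: psiK.
have ts : symmetric_elt t.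
  apply: phi_sym_inv; rewrite phit /symmetric_elt !stardistr.
  by rewrite (phi_sym gs).
suff -> : naone A + g = t by [].
suff : t - naone A - g = 0.
  by move=> H; apply: (eq_of_sub (esym H)); zmod.
set v := _ - g.
have tE : t = naone A + (g + v) by rewrite /v; zmod.
have lie_v h : symmetric_elt h -> star_lie h v = 0.
  move=> hs; have H : star_lie h t = star_lie h g.
    apply: phi_inj; rewrite !phi_star_lie // phit /star_lie (phi_sym hs).
    by rewrite !nadistr; zmod.
  apply: (eq_of_sub H); rewrite tE /star_lie hs !nadistr; zmod.
have vE i : E i ** v = v ** E i.
  have := lie_v _ (frame_sym frame i).
  by rewrite /star_lie (frame_sym frame) => /eqP; rewrite subr_eq0 => /eqP.
apply: (diag_eq0 frame E_faithful vE) => [k ks ok|h hs oh]; last first.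
  by rewrite lie_v // /offdiag /jordan !nadistr; zmod.
have H : offdiag E (jordan k t) = k *+ 2.
  apply: phi_inj; rewrite phi_offdiag_skew; last exact: skew_jordan.
  rewrite phi_jordan // phit.
  have -> : jordan (phi k) (naone A' + phi g) = phi k *+ 2 + phi (jordan k g).
    by rewrite phi_jordan // /jordan !nadistr; zmod.
  rewrite offdiagD -phi_offdiag_skew; last exact: skew_jordan.
  rewrite (offdiag_jordan frame ok og) phi_zero addr0 mulr2n offdiagD.
  by rewrite -phi_offdiag_skew // ok phi_muln mulr2n.
have E1 : jordan k t = (k + k) + jordan k g + jordan k v.
  by rewrite tE /jordan !nadistr; zmod.
rewrite E1 3!offdiagD ok (offdiag_jordan frame ok og) in H.
by apply: (eq_of_sub H); zmod.
Qed.

(* With [g = [e, l]], the off-diagonal part of [[k/2 + e, 1 + g]_*] is [k + l]. *)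
Lemma phi_add_offdiag_skew k l :
  skew_elt k -> offdiag E k = k -> skew_elt l -> offdiag E l = l ->
  phi (k + l) = phi k + phi l.
Proof.
move=> ks ok ls ol.
set e := E true; set g := star_lie e l.
have es : symmetric_elt e by exact: frame_sym frame true.
have gs : symmetric_elt g by exact: sym_star_lie.
have og : offdiag E g = g by exact: offdiag_star_lie.
have eg : star_lie e g = l by exact: star_lie_frameK.
clearbody g e.
have s1g : symmetric_elt (naone A + g) by rewrite /symmetric_elt !stardistr gs.
have hks := skew_half ks.
have ohk : offdiag E (halve k) = halve k.
  by apply: muln2_inj; rewrite halveK !mulr2n -offdiagD -mulr2n halveK.
set X := star_lie (halve k + e) (naone A + g).
have XE : X = halve k *+ 2 + star_lie e g + jordan (halve k) g.
  by rewrite /X /star_lie !stardistr hks es /jordan !nadistr; zmod.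
rewrite halveK eg in XE.
have oX : offdiag E X = k + l.
  by rewrite XE 2!offdiagD ok ol (offdiag_jordan frame ohk og) addr0.
rewrite -oX phi_offdiag_skew; last exact: skew_star_lie.
rewrite phi_star_lie // phi_add_skew_sym // phi_add1 //.
have -> : star_lie (phi (halve k) + phi e) (naone A' + phi g) =
   phi k + phi l + phi (jordan (halve k) g).
  have -> : phi k = phi (halve k) *+ 2 by rewrite -phi_muln halveK.
  rewrite -[in phi l]eg phi_star_lie // phi_jordan //.
  rewrite /star_lie !stardistr (phi_skew hks) (phi_sym es) /jordan.
  by rewrite !nadistr; zmod.
rewrite 2!offdiagD -!phi_offdiag_skew //; last exact: skew_jordan.
by rewrite ok ol (offdiag_jordan frame ohk og) phi_zero addr0.
Qed.

(* Operations [L] that [phi] intertwines with an additive [L'] and that land in a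
   set where [phi] is already additive do not see the additivity defect of [phi]
   at [a], [b]. *)
Lemma additive_via (P Q : A -> Prop) (L : A -> A) (L' : A' -> A') a b :
  (forall x y, Q x -> Q y -> phi (x + y) = phi x + phi y) ->
  {morph L : x y / x + y} ->
  {morph L' : x y / x + y} ->
  (forall x, P x -> Q (L x) /\ phi (L x) = L' (phi x)) ->
  P a -> P b -> P (psi (phi a + phi b)) ->
  L (psi (phi a + phi b) - (a + b)) = 0.
Proof.
move=> QD LD L'D PL Pa Pb Pt.
have [[Qa La] [Qb Lb] [_ Lt]] := And3 (PL a Pa) (PL b Pb) (PL _ Pt).
have H : L (psi (phi a + phi b)) = L (a + b).
  by apply: phi_inj; rewrite Lt psiK L'D LD QD // La Lb.
apply: (addIr (L (a + b))).
by rewrite -LD subrK add0r.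
Qed.

Definition skew_offdiag_elt x := skew_elt x /\ offdiag E x = x.

(** On symmetric elements every test of [diag_eq0] takes values in off-diagonal skew elements, where
    additivity is known. *)
Lemma phi_add_sym a b :
  symmetric_elt a -> symmetric_elt b -> phi (a + b) = phi a + phi b.
Proof.
move=> sa sb; set t := psi (phi a + phi b).
have phit : phi t = phi a + phi b by exact: psiK.
have st : symmetric_elt t.
  by apply: phi_sym_inv; rewrite phit /symmetric_elt stardistr !phi_sym.
suff H : t - (a + b) = 0 by rewrite -phit -(subrK (a + b) t) H add0r.
have via (L : A -> A) (L' : A' -> A') :
    {morph L : x y / x + y} ->
    {morph L' : x y / x + y} ->
    (forall x, symmetric_elt x ->
       skew_offdiag_elt (L x) /\ phi (L x) = L' (phi x)) ->
    L (t - (a + b)) = 0.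
  move=> LD L'D LP.
  apply: (additive_via (Q := skew_offdiag_elt)) LP _ _ _ => //.
  by move=> x y [sx ox] [sy oy]; exact: phi_add_offdiag_skew.
have vE i : E i ** (t - (a + b)) = (t - (a + b)) ** E i.
  have Es : symmetric_elt (E i) by exact: (frame_sym frame).
  have : star_lie (E i) (t - (a + b)) = 0.
    apply: (via (star_lie (E i)) (star_lie (phi (E i)))).
    - by move=> x y; rewrite /star_lie !nadistr; zmod.
    - by move=> x y; rewrite /star_lie !nadistr; zmod.
    move=> x sx; split; last exact: phi_star_lie.
    by split; [exact: skew_star_lie | exact: offdiag_star_lie].
  by rewrite /star_lie Es => /eqP; rewrite subr_eq0 => /eqP.
apply: (diag_eq0 frame E_faithful vE) => [k ks ok|g gs og].
- apply: (via (fun x => offdiag E (jordan k x))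
              (fun w => offdiag E' (jordan (phi k) w))).
  + by move=> x y; rewrite -offdiagD /jordan !nadistr; congr offdiag; zmod.
  + by move=> x y; rewrite -offdiagD /jordan !nadistr; congr offdiag; zmod.
  move=> x sx; have skx := skew_jordan ks sx.
  split; first by split; [exact: skew_offdiag | exact: offdiag_idem].
  by rewrite phi_offdiag_skew // phi_jordan.
- apply: (via (fun x => offdiag E (star_lie g x))
              (fun w => offdiag E' (star_lie (phi g) w))).
  + by move=> x y; rewrite -offdiagD /star_lie !nadistr; congr offdiag; zmod.
  + by move=> x y; rewrite -offdiagD /star_lie !nadistr; congr offdiag; zmod.
  move=> x sx; have skx := skew_star_lie g sx.
  split; first by split; [exact: skew_offdiag | exact: offdiag_idem].
  by rewrite phi_offdiag_skew // phi_star_lie.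
Qed.

(** The off-diagonal part of the defect vanishes by additivity on off-diagonal skew elements; the
    tests of [diag_skew_eq0] take symmetric values, covered by [phi_add_sym]. *)
Lemma phi_add_skew k l :
  skew_elt k -> skew_elt l -> phi (k + l) = phi k + phi l.
Proof.
move=> sk1 sl; set t := psi (phi k + phi l).
have phit : phi t = phi k + phi l by exact: psiK.
have st : skew_elt t.
  by apply: phi_skew_inv; rewrite phit /skew_elt stardistr !phi_skew // opprD.
suff H : t - (k + l) = 0 by rewrite -phit -(subrK (k + l) t) H add0r.
have vE : forall i, E i ** (t - (k + l)) = (t - (k + l)) ** E i.
  move=> i; apply: (offdiag_comm frame).
  apply: (additive_via (P := skew_elt (A := A)) (Q := skew_offdiag_elt)
            (L' := offdiag E')) => //.
  - by move=> x y [sx ox] [sy oy]; exact: phi_add_offdiag_skew.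
  - exact: offdiagD.
  - exact: offdiagD.
  move=> x sx; split; last exact: phi_offdiag_skew.
  by split; [exact: skew_offdiag | exact: offdiag_idem].
apply: (diag_skew_eq0 frame E_faithful vE) => i s ss.
apply: (additive_via (P := skew_elt (A := A)) (Q := symmetric_elt (A := A))
  (L := fun x => jordan (jordan x (E i)) s)
  (L' := fun w => jordan (jordan w (phi (E i))) (phi s))) => //.
- exact: phi_add_sym.
- by move=> x y; rewrite /jordan !nadistr; zmod.
- by move=> x y; rewrite /jordan !nadistr; zmod.
move=> x sx; have sxe := skew_jordan sx (frame_sym frame i).
by split; [exact: sym_jordan | rewrite !phi_jordan].
Qed.

Lemma phi_add x y : phi (x + y) = phi x + phi y.
Proof.
have phi2 z : phi z *+ 2 = phi (sk z) + phi (sy z).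
  by rewrite phi_sk phi_sy /sk /sy; zmod.
apply: muln2_inj; rewrite mulrnDl !phi2.
have -> : sk (x + y) = sk x + sk y by rewrite /sk stardistr; zmod.
have -> : sy (x + y) = sy x + sy y by rewrite /sy stardistr; zmod.
rewrite (phi_add_skew (skew_sk x) (skew_sk y)).
by rewrite (phi_add_sym (sym_sy x) (sym_sy y)); zmod.
Qed.

Lemma phi_sub x y : phi (x - y) = phi x - phi y.
Proof. by rewrite phi_add phi_opp. Qed.

(** * Images of the idempotents *)

Lemma psi_star_lie_sym h k :
  symmetric_elt h -> skew_elt k ->
  symmetric_elt (psi (star_lie (phi h) (phi k))).
Proof.
move=> sh sk1; apply: phi_sym_inv; rewrite psiK.
by apply: sym_star_lie; [exact: phi_sym | exact: phi_skew].
Qed.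

(** Preservation of [star_lie h k] for skew [k] is not yet known, but one more bracket with a
    symmetric [g] makes [phi_star_lie_lie] applicable, so the defect commutes with [g]. *)
Lemma star_lie_psi_defect h k g :
  symmetric_elt h -> skew_elt k -> symmetric_elt g ->
  star_lie g (psi (star_lie (phi h) (phi k)) - star_lie h k) = 0.
Proof.
move=> sh sk1 sg; set m := psi _.
have sm : symmetric_elt m by exact: psi_star_lie_sym.
have H : star_lie m g = star_lie (star_lie h k) g.
  by apply: phi_inj; rewrite phi_star_lie // phi_star_lie_lie // psiK.
apply: (eq_of_sub (esym H)).
rewrite /star_lie sm sg stardistr !stardistr sh sk1 !nadistr; zmod.
Qed.

Lemma phi_star_lie2 i k : skew_elt k ->
  phi (star_lie (E i) (star_lie (E i) k)) =
  star_lie (E' i) (star_lie (E' i) (phi k)).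
Proof.
move=> sk1; have se : symmetric_elt (E i) by exact: frame_sym frame i.
have := star_lie_psi_defect se sk1 se; set m := psi _ => d.
have sm : symmetric_elt m by exact: psi_star_lie_sym.
have -> : star_lie (E i) (star_lie (E i) k) = star_lie (E i) m.
  by apply: (eq_of_sub (esym d)); rewrite /star_lie !nadistr; zmod.
by rewrite phi_star_lie // psiK.
Qed.

Lemma phi_frame_idem i : E' i ** E' i = E' i.
Proof.
set e := E i; set g := psi (E' i ** E' i).
have phig : phi g = E' i ** E' i by exact: psiK.
have se : symmetric_elt e by exact: frame_sym frame i.
have ee : e ** e = e by exact: frame_idem frame i.
have sg : symmetric_elt g.
  by apply: phi_sym_inv; rewrite phig /symmetric_elt stardistr phi_frame_sym.
rewrite -phig; congr phi.
suff H : g - e = 0 by rewrite -(subrK e g) H add0r.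
have lie_v h : symmetric_elt h -> star_lie h (g - e) = 0.
  move=> sh; have H : star_lie h g = star_lie h e.
    apply: phi_inj; rewrite phi_star_lie // phig /star_lie (phi_sym sh).
    (* This replaces the bracket with a square by the Jordan product of a skew bracket with [E' i],
       which [phi] transports. *)
    rewrite commutator_sqr.
    have -> : phi h ** E' i - E' i ** phi h = phi (star_lie h e).
      by rewrite phi_star_lie // /star_lie (phi_sym sh).
    rewrite -phi_jordan; last exact: skew_star_lie.
    by rewrite /star_lie sh -commutator_sqr ee.
  by apply: (eq_of_sub H); rewrite /star_lie !nadistr; zmod.
have vE j : E j ** (g - e) = (g - e) ** E j.
  have := lie_v _ (frame_sym frame j).
  by rewrite /star_lie (frame_sym frame) => /eqP; rewrite subr_eq0 => /eqP.
apply: (diag_eq0 frame E_faithful vE) => [k ks _|h hs _]; last first.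
  by rewrite lie_v // /offdiag /jordan !nadistr; zmod.
have -> : jordan k (g - e) = 0; last by rewrite /offdiag /jordan !nadistr; zmod.
have H : jordan k g = jordan k e.
  apply: phi_inj; apply: muln2_inj.
  (* Both sides become a double bracket plus a double Jordan product; [phi_star_lie2] matches the
     former, [phi_jordan] the latter. *)
  rewrite phi_jordan // phig jordan_sqr -!phi_muln -[in RHS]ee jordan_sqr.
  have lie_e z : e ** z - z ** e = star_lie e z by rewrite /star_lie se.
  have lie_e' w : E' i ** w - w ** E' i = star_lie (E' i) w.
    by rewrite /star_lie phi_frame_sym.
  rewrite phi_add !lie_e !lie_e' phi_star_lie2 // (jordanC e) (jordanC (E' i)).
  by rewrite phi_jordan ?phi_jordan //; exact: skew_jordan.
by apply: (eq_of_sub H); rewrite /jordan !nadistr; zmod.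
Qed.

(** * Compatibility with the Peirce decompositions *)

Lemma phi_frame : peirce_frame E'.
Proof.
split; [exact: phi_frame_idem | exact: phi_frame_sym |].
by rewrite /E' -phi_add -phi_one; case: frame => _ _ ->.
Qed.

(** The defect commutes with symmetric elements. Against off-diagonal skew [l] both Jordan products
    are diagonal; for [m] this is seen in the target, where [phi m] is a bracket with [E' i]. *)
Lemma phi_star_lie_frame i k : skew_elt k ->
  phi (star_lie (E i) k) = star_lie (E' i) (phi k).
Proof.
move=> sk1; have se : symmetric_elt (E i) by exact: frame_sym frame i.
have d g := @star_lie_psi_defect (E i) k g se sk1.
have sm : symmetric_elt (psi (star_lie (phi (E i)) (phi k))).
  exact: psi_star_lie_sym.
move: d sm; set m := psi _ => d sm.
have phim : phi m = star_lie (E' i) (phi k) by exact: psiK.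
rewrite -phim; congr phi; apply/esym.
suff H : m - star_lie (E i) k = 0.
  by rewrite -(subrK (star_lie (E i) k) m) H add0r.
have lE l : offdiag E l = l -> offdiag E (jordan l (star_lie (E i) k)) = 0.
  by move=> ol; apply: offdiag_jordan => //; exact: offdiag_star_lie.
move: (star_lie (E i) k) d lE => w d lE.
have vE j : E j ** (m - w) = (m - w) ** E j.
  have := d _ (frame_sym frame j).
  by rewrite /star_lie (frame_sym frame) => /eqP; rewrite subr_eq0 => /eqP.
apply: (diag_eq0 frame E_faithful vE) => [l ls ol|h hs _]; last first.
  by rewrite d // /offdiag /jordan !nadistr; zmod.
have lm : offdiag E (jordan l m) = 0.
  apply: phi_inj; rewrite phi_zero phi_offdiag_skew; last exact: skew_jordan.
  rewrite phi_jordan // phim (offdiag_jordan phi_frame) //.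
    by rewrite -phi_offdiag_skew // ol.
  exact: offdiag_star_lie phi_frame _ _.
have -> : jordan l (m - w) = jordan l m + (- jordan l w).
  by rewrite /jordan !nadistr; zmod.
by rewrite offdiagD offdiagN lm lE // oppr0 addr0.
Qed.

Lemma phi_lmul_skew i k : skew_elt k -> phi (E i ** k) = E' i ** phi k.
Proof.
move=> sk1; have sE := frame_sym frame i; have sE' := phi_frame_sym i.
apply: muln2_inj; rewrite -phi_muln.
have -> : (E i ** k) *+ 2 = jordan k (E i) + star_lie (E i) k.
  by rewrite /jordan /star_lie sE; zmod.
rewrite phi_add phi_jordan // phi_star_lie_frame // /jordan /star_lie sE'.
by rewrite /E'; zmod.
Qed.

(** By [star_lie_frameK], [h] is a bracket of [E i] with a skew element, so [phi h] is off-diagonal.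
    On off-diagonal elements, twice left multiplication by [E i] is the identity plus the
    bracket. *)
Lemma phi_lmul_offdiag_sym i h :
  symmetric_elt h -> offdiag E h = h ->
  phi (E i ** h) = E' i ** phi h /\ offdiag E' (phi h) = phi h.
Proof.
move=> sh oh; have sE := frame_sym frame i; have sE' := phi_frame_sym i.
have skl : skew_elt (star_lie (E i) h) by exact: skew_star_lie.
have oh' : offdiag E' (phi h) = phi h.
  rewrite -(star_lie_frameK frame i oh) phi_star_lie_frame //.
  exact: (offdiag_star_lie phi_frame).
split=> //; apply: muln2_inj; rewrite -phi_muln.
have -> : (E i ** h) *+ 2 = jordan h (E i) + star_lie (E i) h.
  by rewrite /jordan /star_lie sE; zmod.
rewrite (jordan_frame frame) // phi_add phi_star_lie //.
rewrite -{1}(jordan_frame phi_frame i oh') /jordan /star_lie sE'.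
by rewrite /E'; zmod.
Qed.

(** It remains to treat symmetric [h]: its diagonal part has zero bracket with [E true], a fact that
    [phi] transports. *)
Lemma phi_offdiag x : phi (offdiag E x) = offdiag E' (phi x).
Proof.
have phio_sym h : symmetric_elt h -> phi (offdiag E h) = offdiag E' (phi h).
  move=> sh; have soh : symmetric_elt (offdiag E h).
    by rewrite /symmetric_elt -(offdiag_star frame) sh.
  have [_ o'] := phi_lmul_offdiag_sym true soh (offdiag_idem frame h).
  have o0 : offdiag E (h - offdiag E h) = 0.
    by rewrite offdiagD offdiagN (offdiag_idem frame) subrr.
  have sd : symmetric_elt (h - offdiag E h).
    by rewrite /symmetric_elt star_add starN sh soh.
  have sE := frame_sym frame true; have sE' := phi_frame_sym true.
  have : star_lie (E true) (h - offdiag E h) = 0.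
    by rewrite /star_lie sE (offdiag_comm frame) // subrr.
  move=> /(congr1 phi); rewrite phi_star_lie // phi_zero phi_sub.
  rewrite /star_lie sE' => /eqP; rewrite subr_eq0 => /eqP.
  move=> /(comm_offdiag phi_frame); rewrite offdiagD offdiagN o' => /eqP.
  by rewrite subr_eq0 => /eqP <-.
rewrite (sk_sy_half x); move: (halve x) => y.
rewrite (phi_add (sk y)) [in LHS]offdiagD [in RHS]offdiagD.
rewrite (phi_add (offdiag E (sk y))).
by rewrite (phi_offdiag_skew (skew_sk y)) (phio_sym _ (sym_sy y)).
Qed.

Lemma phi_lmul_offdiag i x : offdiag E x = x -> phi (E i ** x) = E' i ** phi x.
Proof.
move=> ox; apply: muln2_inj; rewrite -!phi_muln.
have ss : sy x = offdiag E (sy x).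
  by rewrite /sy offdiagD (offdiag_star frame) ox.
have [h _] := phi_lmul_offdiag_sym i (sym_sy x) (esym ss).
have h2 := phi_lmul_skew i (skew_sk x).
have -> : (E i ** x) *+ 2 = E i ** sk x + E i ** sy x.
  by rewrite /sk /sy !nadistr; zmod.
by rewrite phi_add h h2 phi_sk phi_sy /sk /sy !nadistr; zmod.
Qed.

Hypothesis E'_faithful : faithful E'.

(** A test element of the target pulls back to [c] in the component [i], [~~ i] of the source, where
    [c ** h] and [h ** star c] vanish; the transported zero bracket feeds [star_comm_peirce]. *)
Lemma phi_peirce_diag_sym i h : symmetric_elt h -> peirce E i i h ->
  E' (~~ i) ** phi h = 0.
Proof.
move=> sh ch; have sE' := phi_frame_sym.
have hE j : E' j ** phi h = phi h ** E' j.
  apply: (offdiag_comm phi_frame); rewrite -phi_offdiag.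
  by rewrite (comm_offdiag frame (i := i)) ?phi_zero // (proj1 ch) (proj2 ch).
have cE' := diag_peirce phi_frame (hE (~~ i)).
apply: (faithful_l phi_frame E'_faithful cE') => c' cc'.
rewrite negbK in cc'.
have oc' : offdiag E' c' = c' by exact: (peirce_offdiag phi_frame cc').
set c := psi c'; have phic : phi c = c' by exact: psiK.
have oc : offdiag E c = c by apply: phi_inj; rewrite phi_offdiag phic.
have cl : E i ** c = c.
  by apply: phi_inj; rewrite phi_lmul_offdiag // phic (proj1 cc').
have cc : peirce E i (~~ i) c.
  rewrite -cl -{1}oc (frame_offdiag frame); exact: peirce_proj.
rewrite -phic; apply: (star_comm_peirce phi_frame) => //.
  by rewrite negbK phic.
have : star_lie c h = 0.
  rewrite /star_lie (peirce_mul0r frame cc) ?negbK //.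
  by rewrite (peirce_mul0l frame ch (peirce_star frame cc)) subrr.
move=> /(congr1 phi); rewrite phi_star_lie // phi_zero /star_lie => /eqP.
by rewrite subr_eq0 => /eqP.
Qed.

Lemma phi_lmul_diag_sym i j h : symmetric_elt h -> peirce E j j h ->
  phi (E i ** h) = E' i ** phi h.
Proof.
move=> sh ch; have z := phi_peirce_diag_sym sh ch.
have [->|->] := eq_or_negb i j.
  by rewrite (proj1 ch) [LHS](frame_suml phi_frame j) z addr0.
by rewrite z (peirceNl frame ch) phi_zero.
Qed.

Lemma phi_lmul_sym i h : symmetric_elt h -> phi (E i ** h) = E' i ** phi h.
Proof.
move=> sh; set o := offdiag E h; set d := h - o.
have so : symmetric_elt o by rewrite /symmetric_elt -(offdiag_star frame) sh.
have sd : symmetric_elt d by rewrite /symmetric_elt /d star_add starN sh so.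
have dE j : E j ** d = d ** E j.
  apply: (offdiag_comm frame).
  by rewrite offdiagD offdiagN (offdiag_idem frame) subrr.
have dj j : phi (E i ** (E j ** d)) = E' i ** phi (E j ** d).
  apply: (@phi_lmul_diag_sym i j); last exact: (diag_peirce frame (dE j)).
  by rewrite /symmetric_elt star_mul sd (frame_sym frame).
have od := phi_lmul_offdiag i (offdiag_idem frame h).
have hE : h = E true ** d + E false ** d + o.
  by rewrite -(frame_suml frame true) subrK.
rewrite -/o in od; clearbody o d.
by rewrite hE !nmulDr !phi_add !dj od !nmulDr.
Qed.

Lemma phi_lmul i x : phi (E i ** x) = E' i ** phi x.
Proof.
apply: muln2_inj; rewrite -!phi_muln.
have -> : (E i ** x) *+ 2 = E i ** sk x + E i ** sy x.
  by rewrite /sk /sy !nadistr; zmod.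
rewrite phi_add (phi_lmul_skew _ (skew_sk x)) (phi_lmul_sym _ (sym_sy x)).
by rewrite phi_sk phi_sy /sk /sy !nadistr; zmod.
Qed.

Lemma phi_rmul i x : phi (x ** E i) = phi x ** E' i.
Proof.
have -> : x ** E i = star (E i ** star x).
  by rewrite star_mul star_inv (frame_sym frame).
by rewrite phi_star phi_lmul star_mul phi_frame_sym -phi_star star_inv.
Qed.

Lemma phi_peirce i j x : peirce E i j x -> peirce E' i j (phi x).
Proof. by move=> [h h']; split; rewrite -?phi_lmul -?phi_rmul ?h ?h'. Qed.

(** * Multiplicativity on Peirce components *)

Lemma phi_mul_diag_off i x y : peirce E i i x -> peirce E i (~~ i) y ->
  phi (x ** y) = phi x ** phi y.
Proof.
move=> cx cy; have cx' := phi_peirce cx; have cy' := phi_peirce cy.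
rewrite -(peirce_prod_diag_off frame cx cy) phi_lmul phi_rmul.
rewrite phi_star_lie ?phi_sy; last exact: sym_sy.
exact: (peirce_prod_diag_off phi_frame cx' cy').
Qed.

Lemma phi_mul_off_diag i x y : peirce E i (~~ i) x ->
  peirce E (~~ i) (~~ i) y -> phi (x ** y) = phi x ** phi y.
Proof.
move=> cx cy; have cxs := peirce_star frame cx.
have cxs' : peirce E (~~ i) (~~ ~~ i) (star x) by rewrite negbK.
rewrite -[x ** y]star_inv star_mul phi_star.
rewrite (phi_mul_diag_off (peirce_star frame cy) cxs') star_mul -!phi_star.
by rewrite !star_inv.
Qed.

Lemma phi_mul_off_off i x y : peirce E i (~~ i) x ->
  peirce E i (~~ i) y -> phi (x ** y) = phi x ** phi y.
Proof.
move=> cx cy; have cx' := phi_peirce cx; have cy' := phi_peirce cy.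
rewrite -(peirce_prod_off_off frame cx cy) phi_lmul phi_rmul.
rewrite phi_star_lie ?phi_sy; last exact: sym_sy.
exact: (peirce_prod_off_off phi_frame cx' cy').
Qed.

Lemma phi_mul_off i x y : peirce E i (~~ i) x ->
  peirce E (~~ i) i y -> phi (x ** y) = phi x ** phi y.
Proof.
move=> cx cy; have cx' := phi_peirce cx; have cy' := phi_peirce cy.
rewrite -(peirce_prod_off frame cx cy) phi_lmul phi_rmul.
rewrite phi_jordan ?phi_sk; last exact: skew_sk.
exact: (peirce_prod_off phi_frame cx' cy').
Qed.

(** Multiplying the defect by an off-diagonal [c'] and reassociating with [peirce_assoc] in both
    algebras leaves only products covered by [phi_mul_diag_off]. *)
Lemma phi_mul_diag i x y : peirce E i i x ->
  peirce E i i y -> phi (x ** y) = phi x ** phi y.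
Proof.
move=> cx cy; have cx' := phi_peirce cx; have cy' := phi_peirce cy.
have cxy := peirce_mul frame cx cy.
have cxy' := peirce_mul phi_frame cx' cy'.
have cd : peirce E' i i (phi (x ** y) - phi x ** phi y).
  have [h h'] := phi_peirce cxy; have [g g'] := cxy'.
  by split; rewrite !nadistr ?h ?h' ?g ?g'.
suff H : phi (x ** y) - phi x ** phi y = 0.
  by rewrite -(subrK (phi x ** phi y) (phi (x ** y))) H add0r.
apply: (faithful_r phi_frame E'_faithful cd) => c' cc'.
(* Cutting [psi c'] to its corner places [c] in the right component without changing its image. *)
set c := E i ** (psi c' ** E (~~ i)).
have cc : peirce E i (~~ i) c by exact: (peirce_proj frame).
have phic : phi c = c'.
  by rewrite phi_lmul phi_rmul psiK (proj2 cc') (proj1 cc').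
rewrite -phic in cc' *.
rewrite !nadistr -(phi_mul_diag_off cxy cc) (peirce_assoc frame cx cy cc).
rewrite (phi_mul_diag_off cx (peirce_mul frame cy cc)).
rewrite (phi_mul_diag_off cy cc) (peirce_assoc phi_frame cx' cy' cc').
exact: subrr.
Qed.

(** With different inner indices, only two factors from the same off-diagonal component can have a
    nonzero product. *)
Lemma phi_mul_peirce (i j k l : bool) x y : peirce E i j x -> peirce E k l y ->
  phi (x ** y) = phi x ** phi y.
Proof.
move=> cx cy; have cx' := phi_peirce cx; have cy' := phi_peirce cy.
have [jk|jk] := eq_or_negb k j.
  subst k.
  have [ij|ij] := eq_or_negb i j.
    subst i.
    have [lj|lj] := eq_or_negb l j.
      by subst l; exact: phi_mul_diag cx cy.
    by subst l; exact: phi_mul_diag_off cx cy.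
  subst i.
  have [lj|lj] := eq_or_negb l j.
    by subst l; apply: (@phi_mul_off_diag (~~ j)); rewrite negbK.
  by subst l; apply: (@phi_mul_off (~~ j)); rewrite negbK.
subst k.
have [ij|ij] := eq_or_negb i j.
  subst i; rewrite (peirce_mul0l frame cx cy) phi_zero.
  by rewrite (peirce_mul0l phi_frame cx' cy').
subst i.
have [lj|lj] := eq_or_negb l j.
  by subst l; apply: (@phi_mul_off_off (~~ j)); rewrite negbK.
subst l; rewrite (peirce_mul0r frame cx cy) phi_zero.
by rewrite (peirce_mul0r phi_frame cx' cy').
Qed.

Lemma phi_mul x y : phi (x ** y) = phi x ** phi y.
Proof.
have split4 z : exists z1 z2 z3 z4,
    [/\ z = z1 + z2 + (z3 + z4), peirce E true true z1,
        peirce E true false z2, peirce E false true z3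
      & peirce E false false z4].
  exists (E true ** (z ** E true)), (E true ** (z ** E false)).
  exists (E false ** (z ** E true)), (E false ** (z ** E false)).
  split; try exact: (peirce_proj frame).
  rewrite -!nmulDr (frame_sum frame true) nmul1r.
  by rewrite -nmulDl (frame_sum frame true) nmul1l.
have mr (i j : bool) z : peirce E i j z -> phi (z ** y) = phi z ** phi y.
  move=> cz; have [a [b [c [d [-> ca cb cc cd]]]]] := split4 y.
  rewrite !nmulDr !phi_add !nmulDr (phi_mul_peirce cz ca).
  rewrite (phi_mul_peirce cz cb) (phi_mul_peirce cz cc).
  by rewrite (phi_mul_peirce cz cd).
have [a [b [c [d [-> ca cb cc cd]]]]] := split4 x.
rewrite !nmulDl !phi_add !nmulDl.
by rewrite (mr _ _ _ ca) (mr _ _ _ cb) (mr _ _ _ cc) (mr _ _ _ cd).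
Qed.

Lemma phi_star_isomorphism : star_isomorphism phi.
Proof.
split; [by exists psi | exact: phi_add | exact: phi_mul | exact: phi_scal |].
exact: phi_star.
Qed.

End StarLieMap.

(** * Brackets padded with units *)

Section PaddingByOne.
Variables (K : numFieldType) (A : altStarAlgType K).
Implicit Types x y : A.

Lemma muln_expn2_inj x y m : x *+ 2 ^ m = y *+ 2 ^ m -> x = y.
Proof.
rewrite -!scaler_nat; apply: scalerI.
by rewrite Num.Theory.pnatr_eq0 -lt0n expn_gt0.
Qed.

Lemma star_lieMn x y n : star_lie (x *+ n) y = star_lie x y *+ n.
Proof. by rewrite /star_lie starMn !nadistr mulrnBl. Qed.

(** The first unit produces [sk x]; each later one doubles it, being bracketed with a skew
    element. *)
Lemma foldl_star_lie_one x m :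
  foldl (@star_lie _ A) x (nseq m.+1 (naone A)) = sk x *+ 2 ^ m.
Proof.
have step k : star_lie (sk x *+ 2 ^ k) (naone A) = sk x *+ 2 ^ k.+1.
  rewrite star_lieMn star_lie_skew; last exact: skew_sk.
  by rewrite /jordan !nadistr -mulr2n -mulrnA expnS.
suff foldlE k : foldl (@star_lie _ A) (sk x *+ 2 ^ k) (nseq m (naone A))
    = sk x *+ 2 ^ (k + m).
  have := foldlE 0%N; rewrite add0n expn0 mulr1n => <- /=.
  by rewrite /star_lie !nadistr.
elim: m k => [|m IH] k; first by rewrite addn0.
by rewrite /= step IH addnS addSn.
Qed.

Lemma pstar_cat (s t : seq A) :
  s <> [::] -> pstar (s ++ t) = pstar (pstar s :: t).
Proof. by case: s => //= x s _; rewrite foldl_cat. Qed.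

End PaddingByOne.

(** * From the long bracket to the short ones *)

Section NMap.
Variables (K : numFieldType) (A A' : altStarAlgType K) (phi : A -> A').
Implicit Types x y z : A.

Lemma star_Lie_n_mapP n : star_Lie_n_map phi n <->
  (forall s, size s = n -> phi (pstar s) = pstar (map phi s)).
Proof.
split=> [h s sn|h x]; last by apply: h; exact: size_tuple.
have tn : size s == n by exact/eqP.
exact: (h (Tuple tn)).
Qed.

(* Makes the bracket long enough for the paddings below to need no case split. *)
Lemma star_Lie_n_map_extend n :
  star_Lie_n_map phi n.+1 -> star_Lie_n_map phi (n + n).+1.
Proof.
move=> /star_Lie_n_mapP h; apply/star_Lie_n_mapP => s sn.
have s1 : size (take n.+1 s) = n.+1.
  by rewrite size_takel // sn ltnS leq_addr.
have s2 : size (drop n.+1 s) = n.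
  by rewrite size_drop sn subSS addnK.
rewrite -[s](cat_take_drop n.+1) map_cat !pstar_cat -?h //=.
- by rewrite (h (_ :: _)) //= s2.
- by move=> e; rewrite -(size_map phi) e in s1.
- by move=> e; rewrite e in s1.
Qed.

Hypothesis phi_scal : scalable phi.
Hypothesis phi_one : phi (naone A) = naone A'.
Variable m : nat.
Hypothesis phi_map : star_Lie_n_map phi m.+4.

Let phiMn x n : phi (x *+ n) = phi x *+ n.
Proof. by rewrite -!scaler_nat phi_scal. Qed.

Let phi_seq s : size s = m.+4 -> phi (pstar s) = pstar (map phi s).
Proof. by move: s; apply/star_Lie_n_mapP. Qed.

Lemma n_map_sk x : phi (sk x) = sk (phi x).
Proof.
apply: (@muln_expn2_inj _ _ _ _ m.+2); rewrite -phiMn -!foldl_star_lie_one.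
rewrite (phi_seq (s := x :: nseq m.+3 (naone A))) /= ?size_nseq //.
by rewrite map_nseq phi_one.
Qed.

(** The units stand between [x] and [y], so [y] meets a multiple of [sk x]. *)
Lemma n_map_sk_lie x y :
  phi (star_lie (sk x) y) = star_lie (sk (phi x)) (phi y).
Proof.
apply: (@muln_expn2_inj _ _ _ _ m.+1); rewrite -phiMn -!star_lieMn.
rewrite -!foldl_star_lie_one -!foldl_rcons.
rewrite (phi_seq (s := x :: rcons (nseq m.+2 (naone A)) y)) /=; last first.
  by rewrite size_rcons size_nseq.
by rewrite map_rcons map_nseq phi_one.
Qed.

Lemma n_map_lie_sk x y :
  phi (sk (star_lie x y)) = sk (star_lie (phi x) (phi y)).
Proof.
apply: (@muln_expn2_inj _ _ _ _ m.+1); rewrite -phiMn -!foldl_star_lie_one.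
rewrite (phi_seq (s := x :: y :: nseq m.+2 (naone A))) /= ?size_nseq //.
by rewrite map_nseq phi_one.
Qed.

(** Three entries and at least one unit: this fixes the minimal length four. *)
Lemma n_map_lie_lie_sk x y z :
  phi (sk (star_lie (star_lie x y) z)) =
  sk (star_lie (star_lie (phi x) (phi y)) (phi z)).
Proof.
apply: (@muln_expn2_inj _ _ _ _ m); rewrite -phiMn -!foldl_star_lie_one.
rewrite (phi_seq (s := x :: y :: z :: nseq m.+1 (naone A))) /= ?size_nseq //.
by rewrite map_nseq phi_one.
Qed.

End NMap.

(** * The two directions of the equivalence *)

Lemma star_isomorphism_n_map (K : numFieldType) (A A' : altStarAlgType K)
    (phi : A -> A') n :
  star_isomorphism phi -> star_Lie_n_map phi n.
Proof.
move=> [_ phiD phiM phiZ phiS]; apply/star_Lie_n_mapP => s _.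
(* Covers the empty bracket, whose default value is 0. *)
have phi0 : phi 0 = 0 by rewrite -(scale0r 0) phiZ scale0r.
have phiL x y : phi (star_lie x y) = star_lie (phi x) (phi y).
  by rewrite /star_lie phiD -scaleN1r phiZ scaleN1r !phiM phiS.
case: s => //= x s; elim: s x => //= y s IH x.
by rewrite IH phiL.
Qed.

Theorem corollary3p1 (R : realType) (A A' : altStarAlgType R[i])
  (e1 e2 : A) (n : nat) (phi : A -> A')
  (he2 : e2 = naone A - e1)
  (he1_idem : nontrivial_idempotent e1) (he1_sym : symmetric_elt e1)
  (he2_idem : nontrivial_idempotent e2) (he2_sym : symmetric_elt e2)
  (hn : (2 <= n)%N)
  (phi_bij : bijective phi)
  (phi_unital : phi (naone A) = naone A')
  (phi_scalable : scalable phi)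
  (hA : forall e, e = e1 \/ e = e2 ->
     forall x : A, (forall a : A, ((e ** a) ** x)%NA = 0) -> x = 0)
  (hA' : forall e, e = e1 \/ e = e2 ->
     forall y : A', (forall b : A', ((phi e ** b) ** y)%NA = 0) -> y = 0) :
  star_Lie_n_map phi n <-> star_isomorphism phi.
Proof.
split; last exact: star_isomorphism_n_map.
case: n hn => [|[|n]] // _ phi_n.
(* Two extensions lead from length [n + 2] to [2n + 3] and then [4n + 5]; a single one would give
   only three when the original bracket is binary. *)
have phi_map : star_Lie_n_map phi (n + n + (n + n)).+1.+4.
  have := star_Lie_n_map_extend (star_Lie_n_map_extend phi_n).
  by rewrite !(addSn, addnS).
have [psi phiK psiK] := phi_bij.
pose E (i : bool) := if i then e1 else e2.
have E12 i : E i = e1 \/ E i = e2 by case: i; [left | right].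
have frame : peirce_frame E.
  split; first by case; [case: he1_idem | case: he2_idem].
    by case.
  by rewrite /= he2 addrC subrK.
apply: (phi_star_isomorphism phiK psiK phi_scalable phi_unital _ _ _ _ frame).
- exact: (n_map_sk phi_scalable phi_unital phi_map).
- exact: (n_map_sk_lie phi_scalable phi_unital phi_map).
- exact: (n_map_lie_sk phi_scalable phi_unital phi_map).
- exact: (n_map_lie_lie_sk phi_scalable phi_unital phi_map).
- by move=> i; apply: hA.
- by move=> i; apply: (hA' (E i)).
Qed.
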